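(* Let $a_1<a_2<a_3$ be positive integers with $\gcd(a_1,a_2)=1$, let $b$ be a nonnegative integer, and let $$T(a_1,a_2,a_3,b)=\{(x_1,x_2,x_3)\in\mathbb{R}^3 \;|\; x_i\geq 0,\ a_1x_1+a_2x_2+a_3x_3\leq b\}.$$ For $i=0,\dots,\lfloor b/a_3\rfloor$ define $q_i,r_i$ by the Euclidean division $b-a_3 i=q_i(a_1a_2)+r_i$ with $0\le r_i<a_1a_2$. Then $$\#\left(T(a_1,a_2,a_3,b)\cap\mathbb{Z}^3\right)=\sum_{i=0}^{\lfloor b/a_3\rfloor}\left(-\frac{a_1a_2}{2}q_i^2+\frac{a_1+a_2+1+2(b-a_3 i)}{2}q_i+\sum_{j=0}^{\lfloor r_i/a_2\rfloor}\left(\left\lfloor\frac{r_i-ja_2}{a_1}\right\rfloor+1\right)\right).$$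
   Context: $\lfloor\cdot\rfloor$ denotes the floor function and $\#$ denotes cardinality. *)

(* Defs.v *)
From HB Require Import structures.
From mathcomp Require Import all_boot all_order all_algebra finmap.
From mathcomp Require Import all_classical all_reals.

Set Implicit Arguments.
Unset Strict Implicit.
Unset Printing Implicit Defensive.

Import Order.TTheory GRing.Theory Num.Theory.

Local Open Scope classical_set_scope.
Local Open Scope ring_scope.

Definition tetrahedron (R : realType) (a1 a2 a3 b : nat) : set 'rV[R]_3 :=
  [set x | (forall i, 0 <= x 0 i) /\
           a1%:R * x 0 0 + a2%:R * x 0 1 + a3%:R * x 0 2 <= b%:R].

Definition integer_points (R : realType) (n : nat) : set 'rV[R]_n :=
  [set x | forall i, x 0 i \is a Num.int].

Arguments tetrahedron : clear implicits.
Arguments integer_points : clear implicits.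

(* Main.v *)
(* Slicing the tetrahedron by x_3 = i reduces the count to the number N(n) of
   natural solutions of a_1 x + a_2 y <= n, with n = b - a_3 i. Splitting off the
   rows y < a_1 gives N(n + a_1 a_2) = N(n) + sum_(y < a_1) (1 + floor(...)), and
   since gcd(a_1, a_2) = 1 the remainders of these a_1 divisions are exactly
   0, ..., a_1 - 1, so the increment is n + (a_1 a_2 + a_1 + a_2 + 1) / 2.
   Iterating q times from r yields the quadratic term in q. *)
Require Import Defs.
From HB Require Import structures.
From mathcomp Require Import all_boot all_order all_algebra finmap.
From mathcomp Require Import all_classical all_reals.
From mathcomp Require Import ring zify.

Set Implicit Arguments.
Unset Strict Implicit.
Unset Printing Implicit Defensive.

Import Order.TTheory GRing.Theory Num.Theory.

Local Open Scope classical_set_scope.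
Local Open Scope ring_scope.

(** With [y] as the outer index, the size of the list unfolds row by row into the sum over [j] of
    the theorem. *)
Definition triangle_points (a1 a2 n : nat) : seq (nat * nat) :=
  [seq (x, y) | y <- iota 0 (n %/ a2).+1,
                x <- iota 0 ((n - y * a2) %/ a1).+1]%N.

Definition tetrahedron_points (a1 a2 a3 b : nat) : seq (nat * nat * nat) :=
  [seq (p, z) | z <- iota 0 (b %/ a3).+1,
                p <- triangle_points a1 a2 (b - z * a3)]%N.

Lemma mem_triangle_points (a1 a2 n x y : nat) : (0 < a1)%N -> (0 < a2)%N ->
  ((x, y) \in triangle_points a1 a2 n) = (a1 * x + a2 * y <= n)%N.
Proof.
move=> a1_gt0 a2_gt0; apply/allpairsPdep/idP => [[y' [x' []]]|le_n].
  rewrite !mem_iota /= !add0n !ltnS !leq_divRL // => ? ? [-> ->]; lia.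
exists y, x; rewrite !mem_iota /= !add0n !ltnS !leq_divRL //; split=> //; lia.
Qed.

Lemma triangle_points_uniq (a1 a2 n : nat) : uniq (triangle_points a1 a2 n).
Proof.
apply: allpairs_uniq_dep => [|y _|[y x] [y' x'] _ _ /= [-> ->]] //.
  exact: iota_uniq.
exact: iota_uniq.
Qed.

Lemma size_triangle_points (a1 a2 n : nat) :
  size (triangle_points a1 a2 n) =
  (\sum_(0 <= y < (n %/ a2).+1) ((n - y * a2) %/ a1).+1)%N.
Proof.
rewrite size_allpairs_dep sumnE big_map /index_iota subn0.
by apply: eq_bigr => y _; rewrite size_iota.
Qed.

Lemma mem_tetrahedron_points (a1 a2 a3 b x y z : nat) :
  (0 < a1)%N -> (0 < a2)%N -> (0 < a3)%N ->
  ((x, y, z) \in tetrahedron_points a1 a2 a3 b) =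
  (a1 * x + a2 * y + a3 * z <= b)%N.
Proof.
move=> a1_gt0 a2_gt0 a3_gt0; apply/allpairsPdep/idP => [[z' [[x' y'] []]]|le_b].
  rewrite mem_triangle_points // mem_iota /= add0n ltnS leq_divRL //.
  by move=> ? ? [-> -> ->]; lia.
exists z, (x, y); rewrite mem_triangle_points // mem_iota /= add0n ltnS.
by rewrite leq_divRL //; split=> //; lia.
Qed.

Lemma tetrahedron_points_uniq (a1 a2 a3 b : nat) :
  uniq (tetrahedron_points a1 a2 a3 b).
Proof.
apply: allpairs_uniq_dep => [|z _|[z p] [z' p'] _ _ /= [-> ->]] //.
  exact: iota_uniq.
exact: triangle_points_uniq.
Qed.

Lemma size_tetrahedron_points (a1 a2 a3 b : nat) :
  size (tetrahedron_points a1 a2 a3 b) =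
  (\sum_(0 <= z < (b %/ a3).+1) size (triangle_points a1 a2 (b - z * a3)))%N.
Proof.
by rewrite size_allpairs_dep sumnE big_map /index_iota subn0.
Qed.

(* As [a2] is invertible modulo [a1], the residues [(m - y a2) %% a1] are
   [0, ..., a1 - 1] in some order. *)
Lemma sum_residues (a1 a2 m : nat) : coprime a1 a2 -> (a1 * a2 <= m)%N ->
  (\sum_(y < a1) (m - y * a2) %% a1 = \sum_(y < a1) y)%N.
Proof.
case: a1 => [|a1] co_a le_m; first by rewrite !big_ord0.
pose h (y : 'I_a1.+1) : 'I_a1.+1 := inord ((m - y * a2) %% a1.+1)%N.
have hE y : h y = ((m - y * a2) %% a1.+1)%N :> nat.
  by rewrite inordK // ltn_mod.
have h_le y y' : h y = h y' -> (y <= y')%N -> y = y'.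
  move=> /(congr1 val) /= eqh le_y; apply/val_inj/eqP.
  move: eqh; rewrite !hE => /esym/eqP.
  (* The lower bound on [m] keeps the natural subtractions from truncating, so equal residues mean
     that the modulus divides [(y' - y) * a2]. *)
  have le_m' : (y' * a2 <= m)%N.
    by apply: leq_trans le_m; rewrite leq_mul2r ltnW ?orbT.
  rewrite eq_sym eqn_mod_dvd; last by rewrite leq_sub2l // leq_mul2r le_y orbT.
  have -> : (m - y * a2 - (m - y' * a2) = (y' - y) * a2)%N.
    by rewrite mulnBl; lia.
  (* Coprimality cancels [a2]; the modulus then divides [y' - y], which is smaller than it and hence
     zero. *)
  rewrite Gauss_dvdl // => dvd; rewrite eqn_leq le_y /= -subn_eq0.
  apply: contraTT dvd; rewrite -lt0n => lt0; rewrite gtnNdvd //.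
  by have := ltn_ord y'; lia.
have h_inj : injective h.
  move=> y y' eqh; case: (leqP y y') => [|/ltnW] le_y; first exact: h_le.
  by apply/esym/h_le.
by rewrite [RHS](reindex_inj h_inj); apply: eq_bigr => y _; rewrite hE.
Qed.

(** Doubling clears the denominator of the increment, so that the recurrence stays within the
    natural numbers. *)
Lemma size_triangle_points_step (a1 a2 n : nat) :
  (0 < a1)%N -> (0 < a2)%N -> coprime a1 a2 ->
  (2 * size (triangle_points a1 a2 (n + a1 * a2)) =
   2 * size (triangle_points a1 a2 n) + 2 * n + a1 * a2 + a1 + a2 + 1)%N.
Proof.
move=> a1_gt0 a2_gt0 co_a; rewrite !size_triangle_points.
set m := (n + _)%N.
have -> : (m %/ a2).+1 = (a1 + (n %/ a2).+1)%N.
  by rewrite /m addnC divnMDl // addnS.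
rewrite (@big_cat_nat _ _ _ a1) ?leq_addr //=.
(* Row [y + a1] for [m] has the length of row [y] for [n], since
   [m - (y + a1) * a2 = n - y * a2]. *)
have -> : (\sum_(a1 <= y < a1 + (n %/ a2).+1) ((m - y * a2) %/ a1).+1 =
    \sum_(0 <= y < (n %/ a2).+1) ((n - y * a2) %/ a1).+1)%N.
  rewrite -{1}[a1]add0n big_addn addKn; apply: eq_bigr => y _.
  by rewrite /m mulnDl; congr ((_ %/ _).+1)%N; lia.
set N := (\sum_(_ <= _ < _.+1) _)%N; rewrite big_mkord.
have res := @sum_residues a1 a2 m co_a (leq_addl _ _).
have sumI : (2 * \sum_(y < a1) y = a1 * a1.-1)%N.
  rewrite -(big_mkord xpredT id) bin2_sum bin2 mul2n -[RHS]odd_double_half.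
  by rewrite oddM; case: (a1) => //= k; case: odd.
have sumS : (\sum_(y < a1) ((m - y * a2) %/ a1).+1 =
   \sum_(y < a1) ((m - y * a2) %/ a1) + a1)%N.
  rewrite (eq_bigr (fun y : 'I_a1 => ((m - y * a2) %/ a1 + 1)%N)); last first.
    by move=> y _; rewrite addn1.
  by rewrite big_split /= sum_nat_const card_ord muln1.
(* Add up the Euclidean divisions of [m - y * a2] by [a1] over all [y < a1]; by [res] the remainders
   contribute the sum of the [y]. *)
have div : ((\sum_(y < a1) ((m - y * a2) %/ a1)) * a1 + \sum_(y < a1) y +
    (\sum_(y < a1) y) * a2 = a1 * m)%N.
  rewrite -{1}res !big_distrl /= -!big_split /=.
  rewrite (eq_bigr (fun=> m)) ?sum_nat_const ?card_ord // => y _.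
  rewrite -divn_eq subnK // /m; apply: leq_trans (leq_addl _ _).
  by rewrite leq_mul2r ltnW ?orbT.
rewrite sumS; move: div sumI.
set S := (\sum_(y < a1) ((m - y * a2) %/ a1))%N.
set T := (\sum_(y < a1) y)%N => div sumI.
(* This is twice [div], with [2 * T] replaced through [sumI] and the common factor [a1]
   cancelled. *)
suff : (2 * S + (a2 + 1) * a1.-1 = 2 * m)%N.
  by rewrite /m; case: (a1) a1_gt0 => // k _ /=; nia.
apply/eqP; rewrite -(eqn_pmul2r a1_gt0); apply/eqP; nia.
Qed.

(** The [q] increments add up to a quadratic in [q] with leading coefficient [a1 * a2 / 2]. Writing
    its linear term with the full bound [q * (a1 * a2) + r] instead of [r] turns that coefficient
    into its opposite. *)
Lemma size_triangle_points_quasipoly (F : numFieldType) (a1 a2 q r : nat) :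
  (0 < a1)%N -> (0 < a2)%N -> coprime a1 a2 ->
  (size (triangle_points a1 a2 (q * (a1 * a2) + r)))%:R =
  - ((a1%:R * a2%:R) / 2) * q%:R ^+ 2
  + (a1%:R + a2%:R + 1 + 2 * (q * (a1 * a2) + r)%:R) / 2 * q%:R
  + (size (triangle_points a1 a2 r))%:R :> F.
Proof.
move=> a1_gt0 a2_gt0 co_a; elim: q => [|q IHq].
  by rewrite !mul0n !add0n expr0n /= !mulr0 !add0r.
have -> : (q.+1 * (a1 * a2) + r = q * (a1 * a2) + r + a1 * a2)%N by lia.
have /(congr1 (fun k => k%:R : F)) :=
  size_triangle_points_step (q * (a1 * a2) + r) a1_gt0 a2_gt0 co_a.
rewrite !(natrD, natrM) IHq !(natrD, natrM) -natr1 => step.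
apply: (mulfI (_ : 2 != 0)); first by rewrite pnatr_eq0.
by rewrite step; field.
Qed.

Lemma truncn_divr (R : archiRealFieldType) (m d : nat) :
  Num.truncn (m%:R / d%:R : R) = (m %/ d)%N.
Proof.
(* For [d = 0] both divisions are 0 by convention. *)
have [->|d_gt0] := posnP d; first by rewrite invr0 mulr0 divn0 truncn0.
apply: truncn_def; rewrite ler_pdivlMr ?ltr0n // ltr_pdivrMr ?ltr0n //.
by rewrite -!natrM ler_nat ltr_nat leq_divM ltn_ceil.
Qed.

Lemma floor_divr (R : archiRealFieldType) (m d : nat) :
  Num.floor (m%:R / d%:R : R) = (m %/ d)%N%:Z.
Proof.
have [->|d_gt0] := posnP d; first by rewrite invr0 mulr0 divn0 floor0.
apply: floor_def; rewrite ler_pdivlMr ?ltr0n // ltr_pdivrMr ?ltr0n //.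
by rewrite -PoszD addn1 -!pmulrn -!natrM ler_nat ltr_nat leq_divM ltn_ceil.
Qed.

Definition lattice_point (R : realType) (t : nat * nat * nat) : 'rV[R]_3 :=
  \row_i (nth 0%N [:: t.1.1; t.1.2; t.2] i)%:R.

Lemma lattice_point_inj (R : realType) : injective (@lattice_point R).
Proof.
move=> [[x y] z] [[x' y'] z'] /rowP eqt.
by have /eqP := eqt 0; have /eqP := eqt 1; have /eqP := eqt 2;
   rewrite !mxE /= !eqr_nat => /eqP -> /eqP -> /eqP ->.
Qed.

Lemma tetrahedron_integer_points (R : realType) (a1 a2 a3 b : nat) :
  (0 < a1)%N -> (0 < a2)%N -> (0 < a3)%N ->
  tetrahedron R a1 a2 a3 b `&` integer_points R 3 =
  [set` map (@lattice_point R) (tetrahedron_points a1 a2 a3 b)].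
Proof.
move=> a1_gt0 a2_gt0 a3_gt0; apply/seteqP; split=> u.
  case=> -[u_ge0 u_le] u_int.
  have u_nat i : u 0 i = (Num.truncn (u 0 i))%:R.
    by rewrite truncnK // natrEint u_int u_ge0.
  pose t := (Num.truncn (u 0 0), Num.truncn (u 0 1), Num.truncn (u 0 2)).
  have -> : u = lattice_point R t.
    apply/rowP => i; rewrite !mxE u_nat.
    by case: i => [[|[|[|?]]] ?] //=; congr (Num.truncn (u _ _))%:R;
      apply/val_inj.
  apply: map_f; rewrite mem_tetrahedron_points //.
  move: u_le; rewrite (u_nat 0) (u_nat 1) (u_nat 2) -!natrM -!natrD ler_nat.
  by rewrite !natrK.
move=> /mapP[[[x y] z]]; rewrite mem_tetrahedron_points // => le_b ->.
split; last by move=> i; rewrite mxE intr_nat.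
split; first by move=> i; rewrite mxE.
by rewrite !mxE /= -!natrM -!natrD ler_nat.
Qed.

(** Finiteness is part of the claim because [fset_set] only reflects the cardinality of a finite
    set. *)
Lemma fset_set_tetrahedron (R : realType) (a1 a2 a3 b : nat) :
  (0 < a1)%N -> (0 < a2)%N -> (0 < a3)%N ->
  let P := tetrahedron R a1 a2 a3 b `&` integer_points R 3 in
  finite_set P /\ #|` fset_set P | = size (tetrahedron_points a1 a2 a3 b).
Proof.
move=> a1_gt0 a2_gt0 a3_gt0 P.
rewrite {}/P tetrahedron_integer_points //; split; first exact: finite_seq.
set s := map _ _.
have -> : [set` s] = [set` [fset x in s]%fset].
  by apply/seteqP; split=> x /=; rewrite in_fset.
rewrite set_fsetK card_fseq undup_id ?size_map //.
by rewrite (map_inj_uniq (@lattice_point_inj R)) tetrahedron_points_uniq.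
Qed.

Theorem theorem5p1 (R : realType) (a1 a2 a3 b : nat) (q r : nat -> nat)
  (ha1 : (0 < a1)%N) (ha12 : (a1 < a2)%N) (ha23 : (a2 < a3)%N)
  (hgcd : gcdn a1 a2 = 1%N)
  (hqr : forall i : nat, (i <= Num.truncn (b%:R / a3%:R : R))%N ->
     (b%:Z - a3%:Z * i%:Z = (q i)%:Z * (a1%:Z * a2%:Z) + (r i)%:Z) /\
     (r i < a1 * a2)%N) :
  let P := tetrahedron R a1 a2 a3 b `&` integer_points R 3 in
  finite_set P /\
  (#|` fset_set P |)%:R =
    \sum_(0 <= i < (Num.truncn (b%:R / a3%:R : R)).+1)
      (- ((a1%:R * a2%:R) / 2) * (q i)%:R ^+ 2
       + (a1%:R + a2%:R + 1 + 2 * (b%:R - a3%:R * i%:R)) / 2 * (q i)%:R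
       + \sum_(0 <= j < (Num.truncn ((r i)%:R / a2%:R : R)).+1)
           ((Num.floor (((r i)%:R - j%:R * a2%:R) / a1%:R : R))%:~R + 1)) :> R.
Proof.
have a2_gt0 := ltn_trans ha1 ha12; have a3_gt0 := ltn_trans a2_gt0 ha23.
move=> P; have [finP cardP] := fset_set_tetrahedron R b ha1 a2_gt0 a3_gt0.
split=> //; rewrite cardP size_tetrahedron_points truncn_divr natr_sum.
move: hqr; rewrite truncn_divr => hqr.
rewrite !big_nat; apply: eq_bigr => i /=; rewrite ltnS => le_i.
have [b_eq _] := hqr i le_i.
(* The range of [i] ensures that [b - i * a3] does not truncate and so agrees with the real
   difference. *)
have le_b : (i * a3 <= b)%N by rewrite -leq_divRL.
have n_eq : (b - i * a3 = q i * (a1 * a2) + r i)%N by lia.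
have -> : b%:R - a3%:R * i%:R = (b - i * a3)%:R :> R.
  by rewrite natrB // natrM mulrC.
rewrite n_eq size_triangle_points_quasipoly //; last exact/eqP.
congr (_ + _); rewrite size_triangle_points truncn_divr natr_sum.
(* Likewise [j * a2 <= r i], so the numerator under the floor is the cast of a natural number. *)
rewrite !big_nat; apply: eq_bigr => j /=; rewrite ltnS leq_divRL // => le_j.
by rewrite -natrM -natrB // floor_divr -natr1 pmulrn.
Qed.
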